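(* Let $\mathcal{F}=((X,d),(f_i)_{i\in I})$ be a generalized possibly infinite iterated function system of order $m\in\mathbb{N}^*$ such that the family of functions $(f_i)_{i\in I}$ is uniformly Meir-Keeler. Then the operator $H_{\mathcal{F}}:\mathcal{C}^m\to\mathcal{C}$ is Meir-Keeler.
   Context: $\mathbb{N}^{*}=\{1,2,\dots\}$. The sets $X$ and $I$ are nonempty. For a metric space $(Y,\rho)$ and $m\in\mathbb{N}^*$, $Y^m$ carries the maximum metric $\rho_{\max}((x_1,\dots,x_m),(y_1,\dots,y_m))=\max_j \rho(x_j,y_j)$. A map $f:Y^m\to Y$ on a metric space $(Y,\rho)$ is Meir-Keeler if for every $\varepsilon>0$ there is $\delta_\varepsilon>0$ such that $\rho(f(x),f(y))<\varepsilon$ for all $x,y\in Y^m$ with $\rho_{\max}(x,y)<\varepsilon+\delta_\varepsilon$. A family $(f_i)_{i\in I}$ of maps $Y^m\to Y$ is uniformly Meir-Keeler if for every $\varepsilon>0$ there are $\delta_\varepsilon,\lambda_\varepsilon>0$ such that $\rho(f_i(x),f_i(y))<\varepsilon-\lambda_\varepsilon$ for all $i\in I$ and all $x,y\in Y^m$ with $\rho_{\max}(x,y)<\varepsilon+\delta_\varepsilon$. A generalized possibly infinite iterated function system of order $m$ is a pair $\mathcal{F}=((X,d),(f_i)_{i\in I})$, where $(X,d)$ is a metric space, each $f_i:X^m\to X$ is continuous, and the family $(f_i)_{i\in I}$ is bounded, i.e. $\bigcup_{i\in I}f_i(B)$ is bounded for every bounded $B\subseteq X^m$. Code space: $\Omega_1=I$,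 $\Omega_{k+1}=\Omega_k\times\dots\times\Omega_k$ ($m$ times), and $\Omega=\Omega_1\times\Omega_2\times\cdots$. Elements of $\Omega$ are written $\alpha=\alpha^1\alpha^2\dots\alpha^k\dots$ with $\alpha^k\in\Omega_k$; for $k\ge2$ write $\alpha^k=\alpha^k_1\alpha^k_2\dots\alpha^k_m$ with $\alpha^k_i\in\Omega_{k-1}$, and for $i\in\{1,\dots,m\}$ put $\alpha(i)=\alpha^2_i\alpha^3_i\alpha^4_i\dots\in\Omega$. $\Omega$ is endowed with the metric $d(\alpha,\beta)=\sum_{k\ge1}c^k\,\delta(\alpha^k,\beta^k)$, where $c\in(0,1)$ is fixed and $\delta(\alpha^k,\beta^k)$ is $1$ if $\alpha^k\neq\beta^k$ and $0$ otherwise. $\mathcal{C}$ is the set of continuous bounded functions $f:\Omega\to X$ with the metric $d_u(f,g)=\sup_{\alpha\in\Omega}d(f(\alpha),g(\alpha))$; $\mathcal{C}^m$ carries the corresponding maximum metric. The operator $H_{\mathcal{F}}:\mathcal{C}^m\to\mathcal{C}$ is $H_{\mathcal{F}}(g_1,\dots,g_m)(\alpha)=f_{\alpha^1}(g_1(\alpha(1)),\dots,g_m(\alpha(m)))$ for $\alpha=\alpha^1\alpha^2\dots\in\Omega$. *)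

(* Defs.v *)
From HB Require Import structures.
From mathcomp Require Import all_boot all_order all_algebra.
From mathcomp Require Import all_classical all_reals all_analysis.

Set Implicit Arguments.
Unset Strict Implicit.
Unset Printing Implicit Defensive.

Import Order.TTheory GRing.Theory Num.Theory.
Import numFieldNormedType.Exports.

Local Open Scope classical_set_scope.
Local Open Scope ring_scope.

(* A power Y^m is represented by row vectors 'rV[Y]_m, whose library topology
   is the product topology and whose library balls are products of balls. The
   maximum metric below is compatible with that structure; the default value 0
   of the iterated maximum is harmless because distances are nonnegative. *)
Section max_metric.
Context {R : realType} {Y : metricType R} {m n : nat}.

Definition mx_dist (x y : 'M[Y]_(m, n)) : R :=
  \big[Num.max/0]_(ij : 'I_m * 'I_n) mdist (x ij.1 ij.2) (y ij.1 ij.2).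

Lemma mx_dist_ge0 x y : 0 <= mx_dist x y.
Proof. exact: bigmax_ge_id. Qed.

Lemma mx_dist_positivity x y : mx_dist x y = 0 -> x = y.
Proof.
move=> xy0; apply/matrixP => i j; apply: mdist_positivity.
apply/eqP; rewrite eq_le mdist_ge0 andbT -xy0.
exact: (le_bigmax _ (fun ij => mdist (x ij.1 ij.2) (y ij.1 ij.2)) (i, j)).
Qed.

Lemma ballE_mx_dist x d : ball x d = [set y | mx_dist x y < d].
Proof.
apply/seteqP; split => y.
  move=> [d0 xy]; apply: bigmax_lt => // -[i j] _.
  by have := xy i j; rewrite ballEmdist.
move=> /bigmax_ltP[d0 xy]; split => // i j.
by rewrite ballEmdist; exact: (xy (i, j)).
Qed.

HB.instance Definition _ := @PseudoMetric_isMetric.Build R 'M[Y]_(m, n)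
  mx_dist mx_dist_ge0 mx_dist_positivity ballE_mx_dist.

End max_metric.

Lemma mdist_rowE (R : realType) (Y : metricType R) (m : nat) (x y : 'rV[Y]_m) :
  mdist x y = \big[Num.max/0]_(j < m) mdist (x 0 j) (y 0 j).
Proof.
apply/le_anti/andP; split.
  apply/bigmax_leP; split; first exact: bigmax_ge_id.
  move=> [i j] _; rewrite (ord1 i).
  exact: (le_bigmax _ (fun j => mdist (x 0 j) (y 0 j)) j).
apply/bigmax_leP; split; first exact: mdist_ge0.
move=> j _.
exact: (le_bigmax _ (fun ij => mdist (x ij.1 ij.2) (y ij.1 ij.2)) (0, j)).
Qed.

Lemma row_continuous (R : realType) (Y : metricType R) (m : nat)
    (T : topologicalType) (h : 'I_m -> T -> Y) :
  (forall j, continuous (h j)) -> continuous (fun t => \row_(j < m) h j t).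
Proof.
move=> hc t; apply/cvg_ballP => e e0; near=> u; split=> // i j; rewrite !mxE.
move: i j => _; near: u; apply: filter_forall => j.
by move/cvg_ballP : (hc j t); apply.
Unshelve. all: by end_near. Qed.

Section metric_notions.
Context {R : realType}.

(* The library only has bounded sets for normed spaces. *)
Definition metric_bounded {Y : metricType R} (A : set Y) : Prop :=
  exists M : R, forall x y, A x -> A y -> mdist x y <= M.

Definition meir_keeler {Y : metricType R} {m : nat} (f : 'rV[Y]_m -> Y) : Prop :=
  forall eps : R, 0 < eps ->
  exists2 delta : R, 0 < delta &
  forall x y : 'rV[Y]_m, mdist x y < eps + delta -> mdist (f x) (f y) < eps.

Definition uniformly_meir_keeler {Y : metricType R} {m : nat} {I : Type}
    (f : I -> 'rV[Y]_m -> Y) : Prop :=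
  forall eps : R, 0 < eps ->
  exists delta lambda : R, [/\ 0 < delta, 0 < lambda &
    forall (i : I) (x y : 'rV[Y]_m),
      mdist x y < eps + delta -> mdist (f i x) (f i y) < eps - lambda].

End metric_notions.

Record gifs (R : realType) (X : metricType R) (I : Type) (m : nat) := Gifs {
  gifs_fun :> I -> 'rV[X]_m -> X ;
  gifs_continuous : forall i, continuous (gifs_fun i) ;
  gifs_bounded : forall B : set 'rV[X]_m, metric_bounded B ->
    metric_bounded (\bigcup_(i in [set: I]) (gifs_fun i @` B)) }.

Record bcfun (R : realType) (T : topologicalType) (X : metricType R) := BCFun {
  bcfun_fun :> T -> X ;
  bcfun_continuous : continuous bcfun_fun ;
  bcfun_bounded : metric_bounded (range bcfun_fun) }.

Section uniform_metric.
Context {R : realType} {T : topologicalType} {X : metricType R}.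
Implicit Types f g h : bcfun T X.

HB.instance Definition _ := gen_eqMixin (bcfun T X).
HB.instance Definition _ := gen_choiceMixin (bcfun T X).

Definition unif_dist f g : R := sup (range (fun t => mdist (f t) (g t))).

Lemma bcfunP f g : f =1 g -> f = g.
Proof.
case: f g => [f cf bf] [g cg bg] /= /funext fg.
by subst g; congr BCFun; exact: Prop_irrelevance.
Qed.

Lemma unif_dist_has_ubound f g : has_ubound (range (fun t => mdist (f t) (g t))).
Proof.
have [[t0 _]|T0] := pselect ([set: T] !=set0); last first.
  by exists 0 => _ [t _ <-]; case: T0; exists t.
have [Mf fM] := bcfun_bounded f; have [Mg gM] := bcfun_bounded g.
exists (Mf + (mdist (f t0) (g t0) + Mg)) => _ [t _ <-].
apply: le_trans (metric_triangle _ (f t0) _) _.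
apply: lerD; first by apply: fM; [exists t|exists t0].
apply: le_trans (metric_triangle _ (g t0) _) _.
by rewrite lerD2l; apply: gM; [exists t0|exists t].
Qed.

Lemma le_unif_dist f g t : mdist (f t) (g t) <= unif_dist f g.
Proof. by apply: ub_le_sup; [exact: unif_dist_has_ubound|exists t]. Qed.

Lemma unif_distxx f : unif_dist f f = 0.
Proof.
rewrite /unif_dist; have [[t0 _]|T0] := pselect ([set: T] !=set0).
  have -> : range (fun t => mdist (f t) (f t)) = [set 0].
    apply/seteqP; split => [_ [t _ <-]|_ ->]; first exact: mdistxx.
    by exists t0 => //; exact: mdistxx.
  exact: sup1.
have -> : range (fun t => mdist (f t) (f t)) = set0.
  by rewrite -subset0 => _ [t _ <-]; apply: T0; exists t.
exact: sup0.
Qed.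

Lemma unif_dist_positivity f g : unif_dist f g = 0 -> f = g.
Proof.
move=> fg0; apply: bcfunP => t; apply: mdist_positivity.
by apply/eqP; rewrite eq_le mdist_ge0 andbT -fg0 le_unif_dist.
Qed.

Lemma unif_dist_sym f g : unif_dist f g = unif_dist g f.
Proof.
rewrite /unif_dist.
suff -> : (fun t => mdist (f t) (g t)) = (fun t => mdist (g t) (f t)) by [].
by apply/funext => t; exact: metric_sym.
Qed.

Lemma unif_dist_triangle g f h :
  unif_dist f h <= unif_dist f g + unif_dist g h.
Proof.
have [[t0 _]|T0] := pselect ([set: T] !=set0).
  apply: ge_sup; first by exists (mdist (f t0) (h t0)), t0.
  move=> _ [t _ <-]; apply: le_trans (metric_triangle _ (g t) _) _.
  by apply: lerD; exact: le_unif_dist.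
have E u v : u = v :> bcfun T X.
  by apply: bcfunP => t; exfalso; apply: T0; exists t.
by rewrite (E f g) (E h g) !unif_distxx addr0.
Qed.

HB.instance Definition _ := isMetric.Build R (bcfun T X)
  unif_distxx unif_dist_positivity unif_dist_sym unif_dist_triangle.

End uniform_metric.

(* Levels are numbered from 0: [code_level I m k] is Omega_{k+1} and, for [a] in the
   code space Omega, [a k] is the component a^{k+1}. *)
Fixpoint code_level (I : Type) (m k : nat) : Type :=
  if k is k'.+1 then 'rV[code_level I m k']_m else I.

(* The ratio [c] of the metric occurs in the type so that the metric can be
   inferred from it. *)
Definition code_space (R : realType) (I : Type) (m : nat) (c : R)
  (c01 : 0 < c < 1) : Type := forall k, code_level I m k.

Section code_metric.
Context {R : realType} {I : Type} {m : nat} {c : R} {c01 : 0 < c < 1}.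
Notation Omega := (code_space I m c01).
Implicit Types a b : Omega.

HB.instance Definition _ := gen_eqMixin Omega.
HB.instance Definition _ := gen_choiceMixin Omega.

Definition code_term a b : R^nat :=
  fun k => c ^+ k.+1 * (`[< a k <> b k >])%:R.

Definition code_dist a b : R := limn (series (code_term a b)).

Let c0 : 0 < c. Proof. by case/andP: c01. Qed.
Let c1 : c < 1. Proof. by case/andP: c01. Qed.

Lemma code_term_ge0 a b k : 0 <= code_term a b k.
Proof. by rewrite mulr_ge0// exprn_ge0// ltW. Qed.

Lemma is_cvg_code_dist a b : cvgn (series (code_term a b)).
Proof.
apply: (@series_le_cvg _ _ (geometric c c)).
- exact: code_term_ge0.
- by move=> k; rewrite geometric_ge0// ltW.
- move=> k; rewrite /code_term /geometric/= exprS ler_piMr//.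
    by rewrite mulr_ge0 ?exprn_ge0// ltW.
  by case: asboolP.
- by apply: is_cvg_geometric_series; rewrite gtr0_norm.
Qed.

Lemma le_code_dist a b n : series (code_term a b) n <= code_dist a b.
Proof.
apply: nondecreasing_cvgn_le; last exact: is_cvg_code_dist.
by apply: nondecreasing_series => k _ _; exact: code_term_ge0.
Qed.

Lemma code_term_le_dist a b k : code_term a b k <= code_dist a b.
Proof.
apply: le_trans (le_code_dist a b k.+1).
rewrite /series/= big_nat_recr//= lerDr.
by apply: sumr_ge0 => j _; exact: code_term_ge0.
Qed.

Lemma code_distxx a : code_dist a a = 0.
Proof.
rewrite /code_dist (_ : series _ = fun=> 0) ?lim_cst//.
apply/funext => n; rewrite /series/= big1// => k _.
by rewrite /code_term; case: asboolP => // _; rewrite mulr0.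
Qed.

Lemma code_dist_positivity a b : code_dist a b = 0 -> a = b.
Proof.
move=> ab0; apply: functional_extensionality_dep => k; apply: contrapT => abk.
have := code_term_le_dist a b k; rewrite ab0 /code_term asboolT// mulr1.
by rewrite leNgt exprn_gt0.
Qed.

Lemma code_dist_sym a b : code_dist a b = code_dist b a.
Proof.
congr (limn (series _)); apply/funext => k; congr (_ * _%:R).
by congr (nat_of_bool _); apply: asbool_equiv_eq; split => h /esym.
Qed.

Lemma code_dist_triangle b a d :
  code_dist a d <= code_dist a b + code_dist b d.
Proof.
have cab := @is_cvg_code_dist a b; have cbd := @is_cvg_code_dist b d.
rewrite /code_dist -lim_seriesD//; apply: lim_series_le.
- exact: is_cvg_code_dist.
- exact: is_cvg_seriesD.
- move=> k; rewrite /= -[leRHS]/(code_term a b k + code_term b d k).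
  rewrite /code_term -mulrDr ler_pM2l ?exprn_gt0// -natrD ler_nat.
  case: asboolP => // ad; case: asboolP => //= /contrapT ab.
  by rewrite asboolT// -ab.
Qed.

HB.instance Definition _ := isMetric.Build R Omega
  code_distxx code_dist_positivity code_dist_sym code_dist_triangle.

(* alpha(i) = alpha^2_i alpha^3_i ..., the sequence of i-th coordinates *)
Definition code_proj a (i : 'I_m) : Omega := fun k => (a k.+1 : 'rV__) 0 i.

Lemma code_head_eq a b : mdist a b < c -> a 0%N = b 0%N.
Proof.
move=> abc; apply: contrapT => ab0.
have := le_lt_trans (code_term_le_dist a b 0) abc.
by rewrite /code_term asboolT// mulr1 expr1 ltxx.
Qed.

Lemma code_proj_dist a b i :
  c * mdist (code_proj a i) (code_proj b i) <= mdist a b.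
Proof.
rewrite -ler_pdivlMl// mulrC; apply: limr_le; first exact: is_cvg_code_dist.
apply: nearW => n; rewrite ler_pdivlMr// mulrC.
apply: le_trans (le_code_dist a b n.+1).
rewrite /series/= big_nat_recl//= mulr_sumr -[leLHS]add0r lerD ?code_term_ge0//.
apply: ler_sum => k _; rewrite /code_term mulrA -exprS.
rewrite ler_pM2l ?exprn_gt0// ler_nat; case: asboolP => // abi.
by rewrite asboolT// => ab; apply: abi; rewrite /code_proj ab.
Qed.

Lemma code_proj_continuous i : continuous (code_proj^~ i).
Proof.
move=> a.
apply/(@metricType_numDomainType.cvgrPdist_lt _ _ _ _ (nbhs_filter a)) => e e0.
rewrite -metricType_numDomainType.filter_from_mdist_nbhs.
exists (c * e) => [|b /= ab]; first exact: mulr_gt0.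
rewrite -(ltr_pM2l c0).
exact: le_lt_trans (code_proj_dist a b i) ab.
Qed.

End code_metric.

Section code_operator.
Context {R : realType} {X : metricType R} {I : Type} {m : nat}.
Context {c : R} (c01 : 0 < c < 1) (F : gifs X I m).
Notation Omega := (code_space I m c01).
Implicit Type g : 'rV[bcfun Omega X]_m.

Definition code_operator_fun g (a : Omega) : X :=
  F (a 0%N) (\row_(j < m) g 0 j (code_proj a j)).

Lemma code_operator_continuous g : continuous (code_operator_fun g).
Proof.
move=> a; rewrite /continuous_at.
have gc : continuous (fun b : Omega => \row_(j < m) g 0 j (code_proj b j)).
  apply: row_continuous => j b.
  apply: (@continuous_comp _ _ _ (code_proj^~ j) (g 0 j)).
    exact: code_proj_continuous.
  exact: bcfun_continuous.
have Fgc : {for a, continuous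
    (fun b => F (a 0%N) (\row_(j < m) g 0 j (code_proj b j)))}.
  by apply: continuous_comp; [exact: gc|exact: gifs_continuous].
have head_a : nbhs a [set b : Omega | a 0%N = b 0%N].
  rewrite -metricType_numDomainType.filter_from_mdist_nbhs.
  by exists c => [|b /= /code_head_eq]; first by case/andP: c01.
move=> P /Fgc; apply: filterS2 head_a => b /= ab.
by rewrite /code_operator_fun ab.
Qed.

Lemma code_operator_bounded g : metric_bounded (range (code_operator_fun g)).
Proof.
pose B : set 'rV[X]_m := [set x | forall j, range (g 0 j) (x 0 j)].
have /(gifs_bounded F)[M FM] : metric_bounded B.
  have /choice[M gM] j := bcfun_bounded (g 0 j).
  exists (\big[Num.max/0]_j M j) => x y Bx By.
  rewrite mdist_rowE; apply/bigmax_leP; split; first exact: bigmax_ge_id.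
  by move=> j _; apply: le_trans (le_bigmax _ M j); exact: gM.
have HB a : (\bigcup_(i in [set: I]) (F i @` B)) (code_operator_fun g a).
  exists (a 0%N) => //; exists (\row_j g 0 j (code_proj a j)) => // j.
  by rewrite mxE; exists (code_proj a j).
by exists M => _ _ [a _ <-] [b _ <-]; exact: FM.
Qed.

Definition code_operator g : bcfun Omega X :=
  BCFun (@code_operator_continuous g) (@code_operator_bounded g).

End code_operator.

Arguments code_operator_fun {R X I m c} c01 F g a.
Arguments code_operator {R X I m c} c01 F g.

(* Main.v *)
Require Import Defs.
From mathcomp Require Import all_boot all_order all_algebra.
From mathcomp Require Import all_classical all_reals all_analysis.

Set Implicit Arguments.
Unset Strict Implicit.
Unset Printing Implicit Defensive.

Import Order.TTheory GRing.Theory Num.Theory.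

Local Open Scope classical_set_scope.
Local Open Scope ring_scope.

(** Fix [eps] and let [delta], [lambda] be the constants that the uniform
    condition on [F] provides; the same [delta] works for the operator.
    Evaluating the coordinates of two rows of functions, each at its own code,
    does not increase their distance ([mdist_row_eval]), so when the rows are
    less than [eps + delta] apart, the values of the operator at any code [a]
    are the images under the single map [F (a 0)] of two points of [X^m] less
    than [eps + delta] apart, hence less than [eps - lambda] apart. The supremum
    over [a] ([unif_dist_le]) turns this strict bound into a weak one, and also
    mixes all the maps of the family: a margin [lambda] common to all of them is
    what keeps the uniform distance strictly below [eps]. *)

(** Nonnegativity of [M] covers an empty [T], where the supremum is 0. *)
Lemma unif_dist_le (R : realType) (T : topologicalType) (X : metricType R)
    (f g : bcfun T X) (M : R) :
  0 <= M -> (forall t, mdist (f t) (g t) <= M) -> mdist f g <= M.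
Proof.
move=> M0 fgM; rewrite -[leLHS]/(sup (range (fun t => mdist (f t) (g t)))).
have [[t0 _]|T0] := pselect ([set: T] !=set0).
  apply: ge_sup; first by exists (mdist (f t0) (g t0)), t0.
  by move=> _ [t _ <-].
suff -> : range (fun t => mdist (f t) (g t)) = set0 by rewrite sup0.
by rewrite -subset0 => _ [t _ <-]; apply: T0; exists t.
Qed.

Lemma mdist_row_eval (R : realType) (T : topologicalType) (X : metricType R)
    (m : nat) (x y : 'rV[bcfun T X]_m) (t : 'I_m -> T) :
  mdist (\row_(j < m) x 0 j (t j)) (\row_(j < m) y 0 j (t j)) <= mdist x y.
Proof.
rewrite !mdist_rowE; apply: le_bigmax2 => j _; rewrite !mxE.
exact: le_unif_dist.
Qed.

Theorem proposition3p4 (R : realType) (X : metricType R) (I : Type) (m : nat)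
    (c : R) (c01 : 0 < c < 1) (F : gifs X I m)
    (X_neq0 : [set: X] !=set0) (I_neq0 : [set: I] !=set0) (m_gt0 : (0 < m)%N)
    (F_mk : uniformly_meir_keeler F) :
  meir_keeler (code_operator c01 F).
Proof.
move=> eps eps0; have [delta [lambda [delta0 lambda0 Fel]]] := F_mk _ eps0.
exists delta => // x y xy.
have [p _] := X_neq0; have [i _] := I_neq0.
(* The uniform condition at a pair of equal points forces [lambda < eps]. *)
have el0 : 0 < eps - lambda.
  have := Fel i (const_mx p) (const_mx p).
  by rewrite !mdistxx; apply; exact: addr_gt0.
apply: (@le_lt_trans _ _ (eps - lambda)); last by rewrite ltrBlDr ltrDl.
apply: unif_dist_le => [|a]; first exact: ltW.
by apply/ltW/Fel/(le_lt_trans _ xy)/mdist_row_eval.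
Qed.
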